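(* Let $n\ge 2$ be even, let $M_1$ and $M_2$ be $n$-dimensional pseudomanifolds, and let $M=M_1\# M_2$ be an $n$-dimensional pseudomanifold that is a connected sum of $M_1$ and $M_2$ (for any choice of bricks and gluing map). Let every facet have weight $1$. Then $$\max(\Omega(M_1),\Omega(M_2))\le\Omega(M).$$
   Context: An $n$-dimensional pseudomanifold is a finite $n$-dimensional simplicial complex such that: it is the union of its $n$-simplices; each $(n-1)$-dimensional face is incident to exactly two $n$-simplices; and the graph with a vertex for each $n$-simplex and an edge joining two vertices exactly when the corresponding simplices share an $(n-1)$-face is connected. The $n$-simplices are called bricks and the $(n-1)$-faces are called facets; each facet is given weight $1$. Connected sum: given distinct $n$-dimensional pseudomanifolds $M_1,M_2$, choose an $n$-simplex $C_i\subset M_i$ for $i=1,2$; $M_1\#M_2$ is the result of removing (the interior of) $C_i$ from $M_i$ and gluing the resulting complexes via some simplicial homeomorphism $\partial C_1\to\partial C_2$. The result depends on the choices of $C_1$, $C_2$ and the gluing map. Width: let $M$ have $N$ bricks, $[N]=\{1,\dots,N\}$, $[N]^*=[N]\cup\{0\}$. An ordering $\mathcal{O}$ is a bijection from the set of bricks to $[N]$. For $j\in[N]^*$, $\Lambda(j)$ is the number of facets shared by a brick $T$ with $\mathcal{O}(T)\le j$ and a brick $T'$ with $\mathcal{O}(T')>j$. A number $t\in[N-1]$ is a (local) maximum for $\mathcal{O}$ if there exist $t_-,t_+\in[N]^*$ with $t_-<t<t_+$, $\Lambda(t_-)<\Lambda(t_-+1)$, $\Lambda(t_+)<\Lambda(t_+-1)$,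 and $\Lambda(t)=\Lambda(k)$ for all $k\in\{t_-+1,\dots,t_+-1\}$. The width $\Omega(\mathcal{O})$ is the sequence of the values of $\Lambda$ at the maxima of $\mathcal{O}$, arranged in non-increasing order (with repetitions). Widths are compared lexicographically (a proper initial segment being smaller). $\Omega(M)$ is the minimal width among all orderings of the bricks of $M$. *)

(* Defs.v *)
From HB Require Import structures.
From mathcomp Require Import all_boot all_order.

Set Implicit Arguments.
Unset Strict Implicit.
Unset Printing Implicit Defensive.

Import Order.TTheory.

(* A finite abstract simplicial complex is given by its set K of nonempty
   faces, each face being its set of vertices.  The ambient type V only
   provides names: it may contain elements that are not vertices of K. *)
Section Complexes.

Variable V : finType.
Implicit Types (K : {set {set V}}) (F B C : {set V}) (n : nat).

Definition simplicial_complex K : Prop :=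
  set0 \notin K /\
  (forall F F', F \in K -> F' \subset F -> F' != set0 -> F' \in K).

(* An i-simplex has i + 1 vertices; in particular the empty complex does not
   have dimension n for any n : nat. *)
Definition has_dim n K : Prop := \max_(F in K) #|F| = n.+1.

Definition bricks n K : {set {set V}} := [set B in K | #|B| == n.+1].

Definition facets n K : {set {set V}} := [set F in K | #|F| == n].

Definition dual_adj n K : rel {set V} := fun B B' =>
  [&& B \in bricks n K, B' \in bricks n K, B != B'
    & [exists F in facets n K, (F \subset B) && (F \subset B')]].

Definition pseudomanifold n K : Prop :=
  [/\ simplicial_complex K,
      has_dim n K,
      forall F, F \in K -> exists2 B, B \in bricks n K & F \subset B,
      forall F, F \in facets n K -> #|[set B in bricks n K | F \subset B]| = 2
    & {in bricks n K &, forall B B', connect (dual_adj n K) B B'}].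

Definition vertices K : {set V} := \bigcup_(F in K) F.

Definition boundary C : {set {set V}} :=
  [set F : {set V} | (F \proper C) && (F != set0)].

End Complexes.

(* A simplicial homeomorphism K -> L, given by its action on vertices; the
   values of f outside the vertices of K are irrelevant. *)
Definition simplicial_homeo (V1 V2 : finType) (K : {set {set V1}})
    (L : {set {set V2}}) (f : V1 -> V2) : Prop :=
  {in vertices K &, injective f} /\ [set f @: F | F : {set V1} in K] = L.

(* In the disjoint union V1 + V2, each vertex v of C1 is identified with
   phi v; the class of v is represented by inr (phi v). *)
Definition glue (V1 V2 : finType) (C1 : {set V1}) (phi : V1 -> V2) (v : V1) :
    (V1 + V2)%type :=
  if v \in C1 then inr (phi v) else inl v.

Definition connected_sum (V1 V2 : finType) (M1 : {set {set V1}})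
    (M2 : {set {set V2}}) (C1 : {set V1}) (C2 : {set V2}) (phi : V1 -> V2) :
    {set {set (V1 + V2)%type}} :=
  [set glue C1 phi @: F | F : {set V1} in M1 :\ C1]
    :|: [set inr @: F | F : {set V2} in M2 :\ C2].

Section Width.

Variables (V : finType) (n : nat) (K : {set {set V}}).

Definition brick := {B : {set V} | B \in bricks n K}.

Definition nb_bricks : nat := #|{: brick}|.

(* Orderings take values in 'I_N = {0, ..., N - 1}; label shifts them to
   {1, ..., N}. *)
Definition is_ordering (O : {ffun brick -> 'I_nb_bricks}) : bool :=
  injectiveb O && [forall j, exists T, O T == j].

Section Ordering.

Variable O : {ffun brick -> 'I_nb_bricks}.

Definition label (T : brick) : nat := (O T).+1.

Definition Lambda (j : nat) : nat :=
  #|[set F in facets n K | [exists T : brick, exists T' : brick,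
      [&& label T <= j, j < label T', F \subset val T & F \subset val T']]]|.

Definition is_local_max (t : nat) : bool :=
  [exists tm : 'I_nb_bricks.+1, exists tp : 'I_nb_bricks.+1,
    [&& tm < t, t < tp,
        Lambda tm < Lambda tm.+1,
        Lambda tp < Lambda tp.-1
      & [forall k : 'I_nb_bricks.+1,
          (tm < k) && (k < tp) ==> (Lambda t == Lambda k)]]].

(* seqlexi is the lexicographic order, for which proper prefixes are
   smaller. *)
Definition ordering_width : seqlexi nat :=
  sort geq [seq Lambda t | t <- iota 1 nb_bricks.-1 & is_local_max t].

End Ordering.

Definition default_ordering : {ffun brick -> 'I_nb_bricks} :=
  [ffun T => enum_rank T].

Lemma default_ordering_is_ordering : is_ordering default_ordering.
Proof.
apply/andP; split.
  by apply/injectiveP => T T'; rewrite !ffunE; apply: enum_rank_inj.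
by apply/forallP => j; apply/existsP; exists (enum_val j); rewrite ffunE enum_valK.
Qed.

Definition width : seqlexi nat :=
  ordering_width
    [arg min_(O < default_ordering | is_ordering O) ordering_width O]%O.

Lemma width_attained : exists2 O, is_ordering O & width = ordering_width O.
Proof.
rewrite /width; case: Order.TotalTheory.arg_minP => [|O ordO _].
  exact: default_ordering_is_ordering.
by exists O.
Qed.

Lemma width_min O : is_ordering O -> (width <= ordering_width O)%O.
Proof.
rewrite /width; case: Order.TotalTheory.arg_minP => [|O' _ minO'].
  exact: default_ordering_is_ordering.
exact: minO'.
Qed.

End Width.

(* Main.v *)
Require Import Defs.
From mathcomp Require Import all_boot all_order zify.

Set Implicit Arguments.
Unset Strict Implicit.
Unset Printing Implicit Defensive.

Import Order.TTheory.

(** Put d = n + 1.  In a pseudomanifold the dual graph, whose vertices are the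
    bricks and whose edges are the facets, is d-regular, and [Lambda] lists the
    sizes of the edge cuts of the prefixes of an ordering ([Lambda_cut]).  As n
    is even, d is odd, so each new brick changes the cut: there are no plateaus,
    and the local maxima are the strict peaks.

    Let M be a connected sum of M1 and M2, and let Q be the set of its bricks
    that come from M1.  Collapsing all the other bricks to one vertex turns the
    dual graph of M into that of M1, the new vertex playing the role of the
    removed brick C1 ([contract_pair]).  Hence, for every set S of bricks of M,
    the cuts of S :&: Q and of S :|: ~: Q are cuts of M1.  The geometric input
    is [link_well_connected]: if k of the d facets of C2 lie in bricks of
    B := S :\: Q, then at least k (d - k) facets separate B from the rest of M2,
    those of C2 not counted.  It follows that passing from S to S :&: Q does not
    increase the cut when k < d / 2, and that passing from S to S :|: ~: Q does
    not when k > d / 2 ([cut_setI_le], [cut_setU_le]).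

    Now take an optimal ordering of M.  Keep the bricks of Q, and put C1 at the
    place of the brick b outside Q at which k passes d / 2.  The cut profile of
    this ordering of M1 lies pointwise below that of M.  This alone does not
    bound the width, as a lower profile may have more peaks.  But the slopes
    compare as well: before b a step down of the new profile is a step down of
    the old one, and after b a step up is a step up.  So from each new peak one
    can climb along the old profile, to the left before b and to the right after
    b, and reach an old peak that is at least as high.  If it is exactly as
    high, then no other new peak leads to it: the two profiles agree only while
    no brick outside Q has been used (or, after b, when all of them have), and
    from there they run in parallel until a step that goes the other way.  Such
    an assignment of peaks gives the lexicographic inequality ([peak_width_le],
    [sort_geq_lexi_le]).  The two summands play symmetric roles, so the same
    argument bounds the width of M2. *)

(** * Peaks and lexicographic comparison *)

Definition peak (f : nat -> nat) (t : nat) : bool :=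
  (f t.-1 < f t) && (f t.+1 < f t).

Definition peaks (f : nat -> nat) (N : nat) : seq nat :=
  [seq t <- iota 1 N.-1 | peak f t].

Definition peak_width (f : nat -> nat) (N : nat) : seqlexi nat :=
  sort geq [seq f t | t <- peaks f N].

Lemma geq_total : total geq.
Proof. by move=> x y; rewrite /geq /= leq_total. Qed.

Lemma geq_trans : transitive geq.
Proof. by move=> x y z /= h1 h2; apply: leq_trans h2 h1. Qed.

Lemma geq_anti : antisymmetric geq.
Proof. by move=> x y /= /andP[h1 h2]; apply/eqP; rewrite eqn_leq h1 h2. Qed.

Lemma sort_geq_cons (y : nat) (X : seq nat) :
  all (geq y) X -> sort geq (y :: X) = y :: sort geq X.
Proof.
move=> yX; apply: (sorted_eq geq_trans geq_anti).
- exact/sort_sorted/geq_total.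
- rewrite /= (path_sortedE geq_trans) all_sort yX /=.
  exact/sort_sorted/geq_total.
- by rewrite perm_sort perm_cons perm_sym perm_sort.
Qed.

Lemma max_in_map (f : nat -> nat) (I : seq nat) :
  I != [::] -> exists2 p, p \in I & forall p', p' \in I -> f p' <= f p.
Proof.
elim: I => // x [|y I] IH _.
  by exists x; rewrite ?mem_head // => p'; rewrite inE => /eqP->.
have [//|p pI pmax] := IH.
case: (leqP (f x) (f p)) => h.
- exists p; first by rewrite inE pI orbT.
  by move=> p'; rewrite inE => /orP[/eqP->//|]; apply: pmax.
- exists x; first exact: mem_head.
  move=> p'; rewrite inE => /orP[/eqP->//|p'I].
  by apply: leq_trans (ltnW h); apply: pmax.
Qed.

(** This is the multiset order for a total order: one sorted list is
    lexicographically below another as soon as each of its entries is assigned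
    to an entry of the other that is at least as large, equality being allowed
    only where the assignment is one-to-one.  By induction, the greatest entries
    are compared and, when equal, removed from both sides. *)
Lemma sort_geq_lexi_le (f g : nat -> nat) (R : nat -> nat -> Prop)
    (I J : seq nat) :
  uniq I -> uniq J ->
  (forall p, p \in I -> exists2 j, j \in J & R p j) ->
  (forall p j, R p j -> g p <= f j) ->
  (forall p p' j, p \in I -> p' \in I ->
     R p j -> R p' j -> g p = f j -> p' = p) ->
  (sort geq [seq g p | p <- I] <= sort geq [seq f j | j <- J] :> seqlexi nat)%O.
Proof.
move=> + + exR leR uniqR.
elim: {I}(size I) {-2}I (erefl (size I)) J exR uniqR => [|m IHm] I szI J exR uniqR uI uJ.
  by rewrite (size0nil szI).
have I0 : I != [::] by case: (I) szI.
have [p0 p0I p0max] := max_in_map g I0.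
have [j0 j0J Rj0] := exR _ p0I.
have J0 : J != [::] by case: (J) j0J.
have [j1 j1J j1max] := max_in_map f J0.
have permI := perm_to_rem p0I.
have gI : sort geq [seq g p | p <- I]
    = g p0 :: sort geq [seq g p | p <- rem p0 I].
  rewrite -sort_geq_cons.
    by apply/(perm_sortP geq_total geq_trans geq_anti); rewrite -map_cons perm_map.
  apply/allP => x /mapP[p /mem_rem pI ->]; exact: p0max.
have fJ j : j \in J -> f j = f j1 -> sort geq [seq f j | j <- J]
    = f j :: sort geq [seq f j | j <- rem j J].
  move=> jJ jj1; rewrite -sort_geq_cons.
    apply/(perm_sortP geq_total geq_trans geq_anti); rewrite -map_cons perm_map //.
    exact: perm_to_rem.
  by apply/allP => x /mapP[p /mem_rem pI ->]; rewrite /= jj1; apply: j1max.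
have le0 : g p0 <= f j1 by apply: leq_trans (leR _ _ Rj0) (j1max _ j0J).
case: (ltngtP (g p0) (f j1)) le0 => // [lt0|eq0] _.
  rewrite gI (fJ j1) // Order.SeqLexiOrder.lexi_cons /=.
  rewrite !leEnat (ltnW lt0) /=; apply/implyP; lia.
have eqj : f j0 = f j1 by have := j1max _ j0J; have := leR _ _ Rj0; lia.
rewrite gI (fJ j0) // Order.SeqLexiOrder.lexi_cons /= eqj eq0 leEnat leqnn /=.
apply: IHm; rewrite ?rem_uniq ?size_rem ?szI //.
- move=> p; rewrite mem_rem_uniq // !inE => /andP[pp0 pI].
  have [j jJ Rj] := exR _ pI; exists j => //.
  rewrite mem_rem_uniq // !inE jJ andbT; apply: contra_neqN pp0 => /eqP jj0.
  apply: (uniqR p0 p j0) => //; first by rewrite -jj0.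
  by rewrite eqj.
- by move=> p p' j /mem_rem pI /mem_rem p'I; apply: uniqR.
Qed.

(** * Comparing the peaks of two profiles *)

Lemma descent_le (f : nat -> nat) (j a : nat) :
  j <= a -> (forall i, j <= i < a -> f i.+1 < f i) ->
  f a <= f j ?= iff (a == j).
Proof.
move=> /subnKC <-; elim: (a - j) => [|m IHm] desc.
  by rewrite addn0 eqxx; apply/leqif_refl.
have {}IHm : f (j + m) <= f j by apply: IHm => i ij; apply: desc; lia.
have := desc (j + m); rewrite addnS => /(_ _) h.
have {}h : f (j + m).+1 < f (j + m) by apply: h; lia.
by split; lia.
Qed.

(** Climbing to the left from a descending step ends at a peak, because the
    profile starts with a step up. *)
Lemma descent_from_peak (f : nat -> nat) (a : nat) :
  (forall i, i < a -> f i <> f i.+1) -> f 0 < f 1 -> f a.+1 < f a ->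
  exists2 j, 0 < j <= a & peak f j /\ forall i, j <= i <= a -> f i.+1 < f i.
Proof.
move=> + f01; elim: a => [|a IHa] noplateau desc; first by lia.
have := noplateau a (leqnn _); case: (ltngtP (f a) (f a.+1)) => // [up|down] _.
- exists a.+1; first by lia.
  split; first by rewrite /peak /= up desc.
  by move=> i ia; have -> : i = a.+1 by lia.
- have [|//|j ja [pk dj]] := IHa; first by move=> i ia; apply: noplateau; lia.
  exists j; first by lia.
  split=> // i ia; case: (eqVneq i a.+1) => [->//|ne]; apply: dj; lia.
Qed.

(** The peak [p] of [g] is assigned to the peak [j] of [f], to the left of the
    time [t] at which the special brick enters: the descent of [f] from [j]
    reaches an anchor [a] of height at least [g p].  The anchor is a time at which
    [g] is at [p], unless [a = t.-1], where [p] may also be the place of the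
    special brick; then the height must exceed [g p]. *)
Definition backed (f g sigma : nat -> nat) (t p j : nat) : Prop :=
  exists a, [/\ j <= a < t, forall i, j <= i <= a -> f i.+1 < f i,
    g p <= f a, a.+1 < t -> sigma a = p & g p = f a -> sigma a = p].

Lemma backed_le f g sigma t p j : backed f g sigma t p j -> g p <= f j.
Proof.
move=> [a [ja desc ga _ _]]; apply: (leq_trans ga).
by case: (@descent_le f j a) => //; [lia | move=> i ia; apply: desc; lia].
Qed.

(** If the peaks [p] and [j] have the same height then the anchor of [p] is [j]
    itself and the profiles agree there.  By [follow] they then agree along the
    whole descent of [f] from [j], on which [g] therefore has no other peak. *)
Lemma backed_uniq f g sigma t p p' j :
  (forall i, i < t -> g (sigma i) = f i -> f i.+1 < f i ->
     [/\ i.+1 < t, sigma i.+1 = (sigma i).+1 & g (sigma i.+1) = f i.+1]) ->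
  backed f g sigma t p j -> backed f g sigma t p' j ->
  g p = f j -> g p'.-1 < g p' -> p' = p.
Proof.
move=> follow [a [ja desc ga _ sa]] [a' [ja' desc' ga' sa' _]] gp up.
have [le_aj eq_aj] : f a <= f j ?= iff (a == j).
  by apply: descent_le; [lia | move=> i ia; apply: desc; lia].
have aj : a = j by apply/eqP; rewrite -eq_aj eqn_leq le_aj -gp ga.
move: sa ja; rewrite {}aj {a le_aj eq_aj desc ga} => /(_ gp) sj jt.
have steps i : j <= i <= a' ->
    [/\ i.+1 < t, g (sigma i) = f i & sigma i.+1 = (sigma i).+1].
  move=> /andP[/subnKC <-]; elim: (i - j) => [|m IHm] ia.
    rewrite addn0 in ia *.
    case: (follow j) => [|||h1 h2 h3]; rewrite ?sj ?desc' //; try lia.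
    by split=> //; lia.
  have [|h1 h2 h3] := IHm; first by lia.
  rewrite addnS in ia *.
  have [||| _ _ g1] := follow (j + m); rewrite ?desc' //; try lia.
  by case: (follow (j + m).+1) => [|||h4 h5 h6]; rewrite ?desc' //; lia.
have {}sa' : sigma a' = p' by apply: sa'; case: (steps a') => //; lia.
case: (eqVneq a' j) => [a'j | ne]; first by rewrite -sa' a'j.
have [|_ g1 s1] := steps a'.-1; first by lia.
(* If a' were beyond j, then g would be higher just before p' than at p'. *)
have a'S : a'.-1.+1 = a' by lia.
rewrite a'S sa' in s1.
have := desc' a'.-1; rewrite a'S => h.
have {}h : f a' < f a'.-1 by apply: h; lia.
have [|_ g2 _] := steps a'; first by lia.
rewrite sa' in g2; rewrite s1 /= in up g2; lia.
Qed.

(** Here [f] is the profile of the large ordering, [g] that of the small one;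
    [sigma j] counts the steps of the small ordering made up to time [j], [q j]
    tells whether the step from [j] to [j.+1] is one of them, and the special
    brick enters at the step from [t.-1] to [t]. *)
Section PeakWidth.

Variables (f g sigma : nat -> nat) (q : pred nat) (t N N1 : nat).
Hypothesis t_range : 0 < t <= N.
Hypothesis f_noplateau : forall j, j < N -> f j <> f j.+1.
Hypothesis f_start : f 0 < f 1.
Hypothesis f_end : f N < f N.-1.
Hypothesis g_le : forall j, j <= N -> g (sigma j) <= f j.
Hypothesis sigma0 : sigma 0 = 0.
Hypothesis sigmaN : sigma N = N1.
Hypothesis sigmaS : forall j, j < N -> sigma j.+1 = sigma j + q j.
Hypothesis qt : q t.-1.
Hypothesis down_before : forall j, j.+1 < t -> q j ->
  g (sigma j.+1) < g (sigma j) -> f j.+1 < f j.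
Hypothesis up_after : forall j, t <= j < N -> q j ->
  g (sigma j) < g (sigma j.+1) -> f j < f j.+1.
Hypothesis tight_before : forall j, j < t -> g (sigma j) = f j ->
  f j.+1 < f j -> [/\ j.+1 < t, q j & g (sigma j.+1) = f j.+1].
Hypothesis tight_after : forall j, t <= j.+1 <= N ->
  g (sigma j.+1) = f j.+1 -> f j < f j.+1 ->
  [/\ t <= j, q j & g (sigma j) = f j].

Lemma sigma_mono i j : i <= j <= N -> sigma i <= sigma j.
Proof.
move=> /andP[/subnKC <-]; elim: (j - i) => [|m IHm] le; first by rewrite addn0.
rewrite addnS sigmaS; last by lia.
by apply: leq_trans (IHm _) (leq_addr _ _); lia.
Qed.

Lemma sigma_step p : p < N1 ->
  exists2 u, u < N /\ q u & sigma u = p /\ sigma u.+1 = p.+1.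
Proof.
move=> pN1.
have ex : exists u, p < sigma u by exists N; rewrite sigmaN.
have [u pu umin] := ex_minnP ex.
have uN : u <= N by apply: umin; rewrite sigmaN.
case: u => [|u] in pu umin uN *; first by rewrite sigma0 in pu.
have up : sigma u <= p by rewrite leqNgt; apply/negP => /umin; rewrite ltnn.
have := sigmaS uN => s; exists u; first by split=> //; move: s; case: (q u) => //; lia.
by move: s; case: (q u) => /=; lia.
Qed.

(* Time reversal, which exchanges the two sides of the special step. *)
Let f' i := f (N - i).
Let g' i := g (N1 - i).
Let sigma' i := N1 - sigma (N - i).
Let t' := (N - t).+1.

Let near p j :=
  backed f g sigma t p j \/
  [/\ p <= N1, j <= N & backed f' g' sigma' t' (N1 - p) (N - j)].

Lemma backed_left p a : a < t -> f a.+1 < f a -> g p <= f a ->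
  (a.+1 < t -> sigma a = p) -> (g p = f a -> sigma a = p) ->
  exists2 j, j \in peaks f N & near p j.
Proof.
move=> at_ fa ga sa1 sa2.
have [|j ja [pk desc]] := @descent_from_peak f a _ f_start fa.
  by move=> i ia; apply: f_noplateau; lia.
exists j; first by rewrite mem_filter pk mem_iota; lia.
by left; exists a; split => //; lia.
Qed.

Lemma backed_right p a : t <= a <= N -> f a.-1 < f a -> p <= N1 -> g p <= f a ->
  (t < a -> sigma a = p) -> (g p = f a -> sigma a = p) ->
  exists2 j, j \in peaks f N & near p j.
Proof.
move=> ta fa pN ga sa1 sa2.
have [|||j ja [pk desc]] := @descent_from_peak f' (N - a).
- move=> i ia; rewrite /f'.
  have := @f_noplateau (N - i.+1); have -> : (N - i.+1).+1 = N - i by lia.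
  by move=> h /esym; apply: h; lia.
- by rewrite /f' subn0 subn1.
- rewrite /f'; have -> : N - (N - a) = a by lia.
  by have -> : N - (N - a).+1 = a.-1 by lia.
exists (N - j).
  rewrite mem_filter mem_iota; apply/andP; split; last by lia.
  move: pk; rewrite /peak /f' => /andP[].
  have -> : N - j.-1 = (N - j).+1 by lia.
  have -> : N - j.+1 = (N - j).-1 by lia.
  by move=> -> ->.
right; split=> //; first by lia.
have -> : N - (N - j) = j by lia.
have Na : N - (N - a) = a by lia.
have pK : N1 - (N1 - p) = p by lia.
exists (N - a); rewrite /g' /sigma' !Na pK; split => //.
- by rewrite /t'; lia.
- by rewrite /f' Na.
- by move=> h; rewrite sa1 //; move: h; rewrite /t'; lia.
- by rewrite /f' Na => h; rewrite sa2.
Qed.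

(** A peak is entered at a time [u] and left at a time [v].  If it is left before
    the special step then [f] descends at [v]; if it is entered after it then [f]
    ascends at [u].  At the special step itself either direction may occur, and
    it decides the side on which to climb. *)
Lemma peak_near p : p \in peaks g N1 -> exists2 j, j \in peaks f N & near p j.
Proof.
rewrite mem_filter mem_iota => /andP[/andP[gup gdn] pN].
have [|u [uN qu] [su sSu]] := @sigma_step p.-1; first by lia.
have [|v [vN qv] [sv sSv]] := @sigma_step p; first by lia.
have pS : p.-1.+1 = p by lia.
rewrite pS in sSu.
have uv : u < v.
  by rewrite ltnNge; apply/negP => vu; have := @sigma_mono v u; lia.
have gv : g p <= f v by rewrite -sv; apply: g_le; lia.
have gSu : g p <= f u.+1 by rewrite -sSu; apply: g_le; lia.
case: (ltngtP v.+1 t) => [vt|tv|vt].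
- apply: (@backed_left p v) => //; first by lia.
  by apply: down_before => //; rewrite sv sSv.
- have ut : t.-1 <= u.
    rewrite leqNgt; apply/negP => ut.
    have := @sigmaS t.-1; rewrite qt; have -> : t.-1.+1 = t by lia.
    have := @sigma_mono u.+1 t.-1; have := @sigma_mono t v; lia.
  case: (ltngtP u t.-1) ut => // [tu|ut] _.
    apply: (@backed_right p u.+1) => //=; try lia.
    by apply: up_after => //; [lia | rewrite su sSu].
  have tS : t.-1.+1 = t by lia.
  have := @f_noplateau t.-1; rewrite ut tS in sSu gSu *.
  case: (ltngtP (f t.-1) (f t)) => [up|down|e]; last by move=> h; case: h; lia.
    by move=> _; apply: (@backed_right p t) => //; lia.
  by move=> _; apply: (@backed_left p t.-1) => //; rewrite ?tS //; lia.
- have := @f_noplateau v vN.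
  case: (ltngtP (f v) (f v.+1)) => // [up|down] _.
    by apply: (@backed_right p v.+1) => //=; lia.
  by apply: (@backed_left p v) => //; lia.
Qed.

(** Peaks reached from the left lie before [t] and those reached from the right
    do not, so two peaks of [g] with a common target are on the same side. *)
Lemma peak_width_le : (peak_width g N1 <= peak_width f N)%O.
Proof.
apply: (@sort_geq_lexi_le f g near).
- by rewrite filter_uniq // iota_uniq.
- by rewrite filter_uniq // iota_uniq.
- exact: peak_near.
- move=> p j [/backed_le//|[pN jN /backed_le]].
  by rewrite /g' /f' !subKn.
- move=> p p' j; rewrite !mem_filter !mem_iota => pI p'I.
  have [up dn] : g p'.-1 < g p' /\ g p'.+1 < g p'.
    by case/andP: p'I => /andP[].
  move=> [near1|[pN jN near1]] [near2|[p'N jN' near2]].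
  + move=> gp; apply: (backed_uniq _ near1 near2) => //.
    move=> i it /(tight_before it) h /h [h1 h2 h3]; split=> //.
    by rewrite sigmaS ?h2 ?addn1 //; lia.
  + by case: near1 near2 => [a [? _ _ _ _]] [a' [+ _ _ _ _]]; rewrite /t'; lia.
  + by case: near1 near2 => [a [+ _ _ _ _]] [a' [? _ _ _ _]]; rewrite /t'; lia.
  + move=> gp; suff : N1 - p' = N1 - p by lia.
    apply: (backed_uniq _ near1 near2); last first.
    * rewrite /g' !subKn //.
      by have -> : N1 - (N1 - p').-1 = p'.+1 by lia.
    * by rewrite /g' /f' !subKn.
    move=> i; rewrite /t' /g' /sigma' /f' => it.
    have NiS : N - i = (N - i.+1).+1 by lia.
    have s1 : sigma (N - i) <= N1 by rewrite -sigmaN; apply: sigma_mono; lia.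
    have s2 : sigma (N - i.+1) <= N1 by rewrite -sigmaN; apply: sigma_mono; lia.
    rewrite !subKn // => tight lt.
    have [||| h1 h2 h3] := @tight_after (N - i.+1); rewrite -?NiS //; first by lia.
    have := @sigmaS (N - i.+1); rewrite -NiS h2 addn1 => s3.
    split=> //; first by lia.
    rewrite s3; lia.
Qed.

End PeakWidth.

(** * Edge cuts of a graph *)

Definition prefix_set (T : finType) (s : seq T) (j : nat) : {set T} :=
  [set x in take j s].

Section Prefixes.

Variables (T : finType) (s : seq T).
Hypotheses (s_uniq : uniq s) (s_full : forall x, x \in s).

Lemma prefix_set0 : prefix_set s 0 = set0.
Proof. by apply/setP => x; rewrite !inE take0. Qed.

Lemma prefix_set_full : prefix_set s (size s) = setT.
Proof. by apply/setP => x; rewrite !inE take_size s_full. Qed.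

Lemma in_prefix_set j x : (x \in prefix_set s j) = (index x s < j).
Proof. by rewrite inE in_take. Qed.

Lemma prefix_setS x0 j : j < size s ->
  nth x0 s j \notin prefix_set s j /\
  prefix_set s j.+1 = nth x0 s j |: prefix_set s j.
Proof.
move=> js; split; first by rewrite in_prefix_set index_uniq // ltnn.
by apply/setP => x; rewrite !inE (take_nth x0) // mem_rcons inE.
Qed.

End Prefixes.

Section Edges.

Variables (W : finType) (e : rel W).
Implicit Types (A B S : {set W}).

(** Ordered pairs: [edges A A] counts every edge inside [A] twice. *)
Definition edges A B : nat := \sum_(x in A) \sum_(y in B) e x y.

Definition cut S : nat := edges S (~: S).

Definition cut_profile (s : seq W) (j : nat) : nat := cut (prefix_set s j).

Lemma edges_splitl C A B : edges A B = edges (A :&: C) B + edges (A :\: C) B.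
Proof. exact: big_setID. Qed.

Lemma edges_splitr C A B : edges A B = edges A (B :&: C) + edges A (B :\: C).
Proof. by rewrite /edges -big_split; apply: eq_bigr => x _; apply: big_setID. Qed.

Lemma edges_subr A B B' : B \subset B' -> edges A B <= edges A B'.
Proof.
by move=> sub; rewrite (edges_splitr B A B') (setIidPr sub) leq_addr.
Qed.

Lemma edges_subl A A' B : A \subset A' -> edges A B <= edges A' B.
Proof.
by move=> sub; rewrite (edges_splitl A A' B) (setIidPr sub) leq_addr.
Qed.

Lemma edges1l x B : edges [set x] B = \sum_(y in B) e x y.
Proof. by rewrite /edges big_set1. Qed.

Hypothesis e_sym : symmetric e.

Lemma edgesC A B : edges A B = edges B A.
Proof.
rewrite /edges exchange_big; apply: eq_bigr => y _; apply: eq_bigr => x _.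
by rewrite e_sym.
Qed.

Lemma cut_setC S : cut (~: S) = cut S.
Proof. by rewrite /cut setCK edgesC. Qed.

Hypothesis e_irr : irreflexive e.

Variable d : nat.
Hypothesis e_reg : forall x, edges [set x] setT = d.

Lemma cut_setU1 x S : x \notin S ->
  cut (x |: S) + (edges [set x] S).*2 = cut S + d.
Proof.
move=> xS; set T := ~: S :\ x.
have T1 : ~: (x |: S) = T by apply/setP => y; rewrite !inE negb_or.
have T2 : ~: S :&: [set x] = [set x].
  by apply/setP => y; rewrite !inE; case: eqP => [->|_]; rewrite ?andbF ?xS.
have T3 : (x |: S) :&: [set x] = [set x].
  by apply/setP => y; rewrite !inE; case: eqP; rewrite ?andbF.
have T4 : (x |: S) :\: [set x] = S.
  by apply/setP => y; rewrite !inE; case: eqP => [->|_]; rewrite ?(negbTE xS).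
have xx : edges [set x] [set x] = 0 by rewrite edges1l big_set1 e_irr.
have := e_reg x; rewrite (edges_splitr S) setTI setTD (edges_splitr [set x] _ (~: S)).
rewrite T2 xx /cut T1 (edges_splitl [set x] (x |: S)) T3 T4.
rewrite (edges_splitr [set x] S (~: S)) T2 -/T (edgesC S [set x]); lia.
Qed.

(** The cut changes by d minus an even number. *)
Lemma cut_neighbour x S : odd d -> x \notin S -> cut (x |: S) <> cut S.
Proof. by move=> od /cut_setU1 h; lia. Qed.

Lemma cut_profile_noplateau s j : odd d -> uniq s -> (forall x, x \in s) ->
  j < size s -> cut_profile s j <> cut_profile s j.+1.
Proof.
move=> od us fs js; have x0 : W by case: (s) js.
have [nx eqS] := prefix_setS us fs x0 js.
by rewrite /cut_profile eqS => h; apply: (cut_neighbour od nx).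
Qed.

End Edges.

(** The set [Q] stands for the bricks of one summand.  The hypotheses on the
    other side say that its edges to [Q] form d edges no two of which share an
    end outside [Q], and that it has no bottleneck separating them. *)
Section Separation.

Variables (W : finType) (e : rel W) (d : nat) (Q : {set W}).
Hypothesis e_sym : symmetric e.
Hypothesis e_irr : irreflexive e.
Hypothesis e_reg : forall x, edges e [set x] setT = d.
Hypothesis d_odd : odd d.
Hypothesis d_gt2 : 2 < d.
Hypothesis e_conn : forall S, cut e S = 0 -> S = set0 \/ S = setT.
Hypothesis cross_le1 : forall x, x \notin Q -> edges e [set x] Q <= 1.
Hypothesis cross_total : edges e (~: Q) Q = d.
Hypothesis well_linked : forall B : {set W}, B \subset ~: Q ->
  edges e B Q * edges e (~: Q :\: B) Q <= edges e B (~: Q :\: B).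

Let cross (S : {set W}) := edges e (S :\: Q) Q.

Lemma cross_setC S : cross S + cross (~: S) = d.
Proof.
rewrite -cross_total /cross (edges_splitl e S (~: Q)) setIC -setDE.
by congr (_ + edges e _ Q); apply/setP => x; rewrite !inE andbC.
Qed.

(** Put B := S :\: Q and k := cross S.  Passing from S to S :&: Q takes at least
    k (d - k) edges, those from B to the rest of ~: Q, out of the cut and puts
    at most k into it; for 2 k < d this is a gain, strict unless k = 0.  When k = 0 and there is no gain, nothing
    leaves B, which is then empty by connectedness. *)
Lemma cut_setI_le S : (cross S).*2 < d ->
  cut e (S :&: Q) <= cut e S ?= iff (S \subset Q).
Proof.
move=> small; have := cross_setC S; rewrite /cross in small *; move: small.
set A := S :&: Q; set B := S :\: Q; set A' := Q :\: S; set B' := ~: (S :|: Q).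
have eB' : ~: S :\: Q = B' by apply/setP => x; rewrite !inE; do !case: (_ \in _).
have eB'2 : ~: Q :\: B = B' by apply/setP => x; rewrite !inE; do !case: (_ \in _).
rewrite eB' => small tot.
have wl : edges e B Q * edges e B' Q <= edges e B B'.
  rewrite -eB'2; apply: well_linked; apply/subsetP => x.
  by rewrite !inE => /andP[].
have sBQ : edges e B Q = edges e B A + edges e B A'.
  by rewrite (edges_splitr e S) setIC.
have cS : cut e S = edges e A A' + edges e A B' + (edges e B A' + edges e B B').
  rewrite /cut (edges_splitl e Q S) -/A -/B !(edges_splitr e Q _ (~: S)) eB'.
  by have -> : ~: S :&: Q = A' by apply/setP => x; rewrite !inE.
have cA : cut e A = edges e A A' + (edges e A B + edges e A B').
  rewrite /cut (edges_splitr e Q _ (~: A)).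
  have -> : ~: A :&: Q = A' by apply/setP => x; rewrite !inE; do !case: (_ \in _).
  rewrite (edges_splitr e S _ (~: A :\: Q)).
  have -> : (~: A :\: Q) :&: S = B.
    by apply/setP => x; rewrite !inE; do !case: (_ \in _).
  have -> // : (~: A :\: Q) :\: S = B'.
  by apply/setP => x; rewrite !inE; do !case: (_ \in _).
have BA : edges e A B = edges e B A by rewrite edgesC.
have prod : edges e B Q <= edges e B Q * edges e B' Q.
  by apply: leq_pmulr; lia.
split; first by lia.
apply/eqP/idP => [eqc|SQ]; last by rewrite /A (setIidPl SQ).
(* Equality forces k (d - k) <= k, while d - k > 1. *)
have k0 : edges e B Q = 0.
  have [//|k_gt0] := posnP (edges e B Q).
  have : edges e B Q * 2 <= edges e B Q * edges e B' Q by apply: leq_mul => //; lia.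
  lia.
have : cut e B = 0.
  have -> : cut e B = edges e B Q + edges e B B'.
    rewrite /cut (edges_splitr e Q).
    have -> : ~: B :&: Q = Q by apply/setP => x; rewrite !inE; do !case: (_ \in _).
    by have -> : ~: B :\: Q = B' by apply/setP => x; rewrite !inE; do !case: (_ \in _).
  lia.
case/e_conn => [/eqP|BT]; first by rewrite setD_eq0.
have Q0 : Q = set0.
  apply/setP => x; rewrite !inE; apply/negbTE.
  by have := in_setT x; rewrite -BT inE => /andP[].
by move: cross_total; rewrite Q0 /edges big1 => [|x _]; [lia | rewrite big_set0].
Qed.

(** The previous lemma for the complement of S. *)
Lemma cut_setU_le S : d < (cross S).*2 ->
  cut e (S :|: ~: Q) <= cut e S ?= iff (~: Q \subset S).
Proof.
move=> large; have := cross_setC S => tot.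
have := @cut_setI_le (~: S); rewrite (cut_setC e_sym S) subCset.
have -> : ~: S :&: Q = ~: (S :|: ~: Q) by rewrite setCU setCK.
by rewrite (cut_setC e_sym); apply; lia.
Qed.

Section Contraction.

Variables (s : seq W).
Hypotheses (s_uniq : uniq s) (s_full : forall x, x \in s).

Let P j := prefix_set s j.

(** The brick [b] stands for the collapsed vertex: it is the first one whose
    arrival makes more than half of the cross edges leave from the prefix.  The
    slopes compare because a brick of [Q] has at least as many neighbours in [S]
    as in [S :&: Q], and at most as many as in [S :|: ~: Q].  The first brick
    outside [Q] raises the profile, since at most one of its d neighbours
    precedes it; so it cannot arrive during a descent along which the two
    profiles agree.  Symmetrically, the last such brick lowers the profile. *)
Lemma contracted_width : exists2 b, b \notin Q &
  forall g : nat -> nat,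
  (forall j, j <= size s -> g (count (predU1 b (mem Q)) (take j s))
     = cut e (if b \in P j then P j :|: ~: Q else P j :&: Q)) ->
  (peak_width g (count (predU1 b (mem Q)) s) <= peak_width (cut_profile e s) (size s))%O.
Proof.
have crossN : cross (P (size s)) = d.
  by rewrite /cross /P prefix_set_full // setTD.
have cross0 : cross (P 0) = 0.
  by rewrite /cross /P prefix_set0 set0D /edges big_set0.
have ex : exists j, d < (cross (P j)).*2 by exists (size s); lia.
have [t dt tmin] := ex_minnP ex.
have ts : t <= size s by apply: tmin; lia.
case: t => [|t] in dt tmin ts; first by lia.
have before j : j <= t -> (cross (P j)).*2 < d.
  move=> jt; rewrite ltnNge; apply/negP => dj.
  by have /tmin : d < (cross (P j)).*2 by [lia]; lia.
have x0 : W by case: (s) ts.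
pose x_ := nth x0 s.
have PS j : j < size s -> x_ j \notin P j /\ P j.+1 = x_ j |: P j.
  exact: prefix_setS.
have cross_mono j k : j <= k -> cross (P j) <= cross (P k).
  move=> jk; apply/edges_subl/setSD/subsetP => x.
  by rewrite !in_prefix_set // => /leq_trans; apply.
have after j : t < j -> d < (cross (P j)).*2.
  by move=> tj; apply: leq_trans dt _; rewrite leq_double cross_mono.
have [bP PtS] := PS t ts; set b := x_ t in bP PtS.
have bQ : b \notin Q.
  apply/negP => bQ; have := before t (leqnn _).
  have -> : cross (P t) = cross (P t.+1); last by lia.
  rewrite /cross PtS; congr edges; apply/setP => x; rewrite !inE.
  by case: eqP => [->|//]; rewrite bQ.
exists b => // g gE.
have bPj j : (b \in P j) = (t < j) by rewrite in_prefix_set // index_uniq.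
pose q j := predU1 b (mem Q) (x_ j).
have qE j : j < size s -> q j = (j == t) || (x_ j \in Q).
  by move=> js; rewrite /q /= nth_uniq.
pose sigma j := count (predU1 b (mem Q)) (take j s).
have gle j : j <= t -> g (sigma j) = cut e (P j :&: Q).
  by move=> jt; rewrite gE ?bPj; [case: ltnP => //; lia | lia].
have ggt j : t < j <= size s -> g (sigma j) = cut e (P j :|: ~: Q).
  by move=> jt; rewrite gE ?bPj; [case: ltnP => //; lia | lia].
have sigmaS j : j < size s -> sigma j.+1 = sigma j + q j.
  by move=> js; rewrite /sigma (take_nth x0) // -cats1 count_cat /= addn0.
have xQ j : j < size s -> q j -> j != t -> x_ j \in Q.
  by move=> js; rewrite qE // => /orP[->|].
set f := cut_profile e s.
have noplateau j : j < size s -> f j <> f j.+1.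
  by move=> js; apply: (cut_profile_noplateau e_sym e_irr e_reg).
have f0 : f 0 = 0 by rewrite /f /cut_profile prefix_set0 /cut /edges big_set0.
have fN : f (size s) = 0.
  rewrite /f /cut_profile prefix_set_full // /cut setCT /edges big1 // => x _.
  by rewrite big_set0.
apply: (@peak_width_le _ g sigma q t.+1).
- by lia.
- exact: noplateau.
- by move: (noplateau 0) f0; rewrite /f => h; have := h; lia.
- by move: (noplateau (size s).-1) fN; rewrite prednK; lia.
- move=> j js; case: (leqP j t) => jt.
    by rewrite gle //; case: (cut_setI_le (before j jt)).
  by rewrite ggt ?jt //; case: (cut_setU_le (after j jt)).
- by rewrite /sigma take0.
- by rewrite /sigma take_size.
- exact: sigmaS.
- by rewrite /= qE // eqxx.
- move=> j jt qj; have js : j < size s by lia.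
  have xjQ : x_ j \in Q by apply: xQ => //; lia.
  have [nx PjS] := PS j js.
  rewrite !gle; try lia.
  have -> : P j.+1 :&: Q = x_ j |: (P j :&: Q).
    by rewrite PjS setIUl (setIidPl _) // sub1set.
  have := cut_setU1 e_sym e_irr e_reg nx; rewrite -PjS.
  have := @cut_setU1 _ e e_sym e_irr d e_reg (x_ j) (P j :&: Q).
  have := edges_subr e [set x_ j] (subsetIl (P j) Q).
  by rewrite in_setI (negbTE nx) /f /cut_profile -/(P j) -/(P j.+1) => ? /(_ isT); lia.
- move=> j jt qj; have js : j < size s by lia.
  have xjQ : x_ j \in Q by apply: xQ => //; lia.
  have [nx PjS] := PS j js.
  rewrite !ggt; try lia.
  have -> : P j.+1 :|: ~: Q = x_ j |: (P j :|: ~: Q) by rewrite PjS setUA.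
  have := cut_setU1 e_sym e_irr e_reg nx; rewrite -PjS.
  have := @cut_setU1 _ e e_sym e_irr d e_reg (x_ j) (P j :|: ~: Q).
  have := edges_subr e [set x_ j] (subsetUl (P j) (~: Q)).
  rewrite in_setU in_setC xjQ orbF nx /f /cut_profile -/(P j) -/(P j.+1).
  by move=> ? /(_ isT); lia.
- move=> j jt; rewrite ltnS in jt; have js : j < size s by lia.
  have [nx PjS] := PS j js.
  rewrite gle // => /eqP; rewrite (cut_setI_le (before j jt)) => PQ down.
  have xjQ : x_ j \in Q.
    apply: contraLR down => xjQ; rewrite -leqNgt.
    have := cut_setU1 e_sym e_irr e_reg nx; rewrite -PjS.
    have := edges_subr e [set x_ j] PQ; have := cross_le1 xjQ.
    by rewrite /f /cut_profile -/(P j) -/(P j.+1); lia.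
  have jnt : j != t by apply: contraTneq xjQ => ->.
  split; [by lia | by rewrite qE // xjQ orbT |].
  have PQ' : P j.+1 \subset Q by rewrite PjS subUset sub1set xjQ.
  by rewrite gle ?(setIidPl PQ') //; lia.
- move=> j jt; have js : j < size s by lia.
  have [nx PjS] := PS j js.
  rewrite ggt // => /eqP; rewrite (cut_setU_le (after j.+1 _)); last by lia.
  move=> PQ up.
  have xjQ : x_ j \in Q.
    apply: contraLR up => xjQ; rewrite -leqNgt.
    have eqC : ~: P j = x_ j |: ~: P j.+1.
      apply/setP => x; rewrite PjS in_setU1 !in_setC in_setU1 negb_or.
      by case: eqP => [->|].
    have nx' : x_ j \notin ~: P j.+1 by rewrite PjS in_setC negbK setU11.
    have := cut_setU1 e_sym e_irr e_reg nx'; rewrite -eqC !cut_setC //.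
    have PQ' : ~: P j.+1 \subset Q by rewrite subCset.
    have := edges_subr e [set x_ j] PQ'; have := cross_le1 xjQ.
    by rewrite /f /cut_profile -/(P j) -/(P j.+1); lia.
  have jnt : j != t by apply: contraTneq xjQ => ->.
  have tj : t < j by lia.
  split=> //; first by rewrite qE // xjQ orbT.
  have PQ' : ~: Q \subset P j.
    apply/subsetP => x xQ'; have := subsetP PQ x xQ'; rewrite PjS in_setU1.
    by case: eqP xQ' => [->|//]; rewrite in_setC xjQ.
  by rewrite ggt ?(setUidPl PQ') //; lia.
Qed.

End Contraction.
End Separation.

(** * The dual graph of a pseudomanifold *)

Lemma edges_even (W : finType) (e : rel W) (A : {set W}) :
  symmetric e -> irreflexive e -> ~~ odd (edges e A A).
Proof.
move=> e_sym e_irr; have [m] := ubnP #|A|; elim: m A => // m IHm A.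
have [->|[x xA]] := set_0Vmem A; first by rewrite /edges big_set0.
rewrite (cardsD1 x) xA => szA.
have Ax : A :&: [set x] = [set x] by apply/setIidPr; rewrite sub1set.
rewrite (edges_splitl e [set x]) !(edges_splitr e [set x] _ A) Ax.
rewrite (edgesC e_sym (A :\ x) [set x]).
have -> : edges e [set x] [set x] = 0 by rewrite edges1l big_set1 e_irr.
have := IHm (A :\ x); lia.
Qed.

Lemma edges_gt0 (W : finType) (e : rel W) (A B : {set W}) :
  0 < edges e A B -> exists x y, [/\ x \in A, y \in B & e x y].
Proof.
move=> pos; have [[x y] /and3P[/= xA yB exy]|none] :=
  pickP [pred p | [&& p.1 \in A, p.2 \in B & e p.1 p.2]]; first by exists x, y.
move: pos; rewrite /edges big1 // => x xA; rewrite big1 // => y yB.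
by have /= := none (x, y); rewrite xA yB /= => ->.
Qed.

Section DualGraph.

Variables (V : finType) (n : nat) (K : {set {set V}}).
Hypothesis n_gt0 : 0 < n.
Hypothesis K_pm : pseudomanifold n K.
Implicit Types (T : brick n K) (F E : {set V}).

Definition shares_facet T T' : bool := #|val T :&: val T'| == n.

Lemma card_brick T : #|val T| = n.+1.
Proof. by have := valP T; rewrite inE => /andP[_ /eqP]. Qed.

Lemma shares_facet_sym : symmetric shares_facet.
Proof. by move=> T T'; rewrite /shares_facet setIC. Qed.

Lemma shares_facet_irr : irreflexive shares_facet.
Proof.
by move=> T; rewrite /shares_facet setIid card_brick gtn_eqF.
Qed.

Lemma sub_brick_facet T F : F \subset val T -> #|F| = n -> F \in facets n K.
Proof.
move=> FT cF; case: K_pm => -[_ sub] _ _ _ _; rewrite inE cF eqxx andbT.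
have := valP T; rewrite inE => /andP[TK _]; apply: sub TK FT _.
by rewrite -card_gt0 cF.
Qed.

Lemma brick_sub T T' : val T \subset val T' -> T = T'.
Proof.
by move=> sub; apply/val_inj/eqP; rewrite eqEcard sub !card_brick leqnn.
Qed.

Lemma facet_bricks T F : F \subset val T -> #|F| = n ->
  #|[set T' : brick n K | F \subset val T']| = 2.
Proof.
move=> FT cF; case: K_pm => _ _ _ /(_ _ (sub_brick_facet FT cF)) <- _.
rewrite -(card_imset _ val_inj); apply: eq_card => B; rewrite !inE.
apply/imsetP/andP => [[T' + ->]|[BK FB]].
  by rewrite inE => ->; have := valP T'; rewrite inE.
have BK' : B \in bricks n K by rewrite inE.
by exists (Sub B BK') => //; rewrite inE.
Qed.

Lemma facet_brick_uniq F T T1 T2 : #|F| = n ->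
  F \subset val T -> F \subset val T1 -> F \subset val T2 ->
  T1 != T -> T2 != T -> T1 = T2.
Proof.
move=> cF FT FT1 FT2 n1 n2; apply/eqP/negPn/negP => n12.
have := facet_bricks FT cF.
rewrite (cardsD1 T) (cardsD1 T1) (cardsD1 T2) !inE FT FT1 FT2 n1 n2.
by rewrite eq_sym n12.
Qed.

Lemma facet_brick_other F T : #|F| = n -> F \subset val T ->
  exists2 T', T' != T & F \subset val T'.
Proof.
move=> cF FT; have := facet_bricks FT cF; rewrite (cardsD1 T) inE FT add1n => -[c1].
have /card_gt0P[T'] : 0 < #|[set T' : brick n K | F \subset val T'] :\ T|.
  by rewrite c1.
by rewrite !inE => /andP[ne FT']; exists T'.
Qed.

Lemma facet_brick_capE F T T' : #|F| = n -> T != T' ->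
  F \subset val T -> F \subset val T' -> val T :&: val T' = F.
Proof.
move=> cF ne FT FT'; apply/esym/eqP.
rewrite eqEcard subsetI FT FT' cF -ltnS -(card_brick T) /=.
rewrite proper_card // properEneq subsetIl andbT.
by apply: contra_neq ne => /setIidPl; apply: brick_sub.
Qed.

Lemma card_cap_bricks T T' : T != T' -> #|val T :&: val T'| <= n.
Proof.
move=> ne; rewrite -ltnS -(card_brick T) proper_card // properEneq subsetIl andbT.
by apply: contra_neq ne => /setIidPl; apply: brick_sub.
Qed.

Lemma shares_facet_neq T T' : shares_facet T T' -> T' != T.
Proof.
by apply: contraTneq => e; apply/negbT; rewrite e shares_facet_irr.
Qed.

(** Crossing a facet is a bijection from the facets of [T] to its neighbours, and
    the facets of [T] are the complements of its vertices.  The predicate [P]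
    selects facets: all of them gives regularity, those containing a given
    ridge gives the two neighbours around that ridge. *)
Lemma card_cofaces (P : pred {set V}) T :
  #|[set T' | shares_facet T T' & P (val T :&: val T')]| =
  #|[set a in val T | P (val T :\ a)]|.
Proof.
rewrite -(@card_in_imset _ _ (fun T' => val T :&: val T')); last first.
  move=> T1 T2; rewrite !inE => /andP[s1 _] /andP[s2 _] eqF.
  apply: (@facet_brick_uniq (val T :&: val T1) T); rewrite ?subsetIl ?subsetIr //.
  - exact/eqP.
  - by rewrite eqF subsetIr.
  - exact: shares_facet_neq.
  - exact: shares_facet_neq.
rewrite -[RHS](@card_in_imset _ _ (fun a => val T :\ a)); last first.
  move=> a b; rewrite !inE => /andP[aT _] /andP[bT _] /setP/(_ a).
  by rewrite !inE eqxx aT andbT; case: eqP.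
have cD a : a \in val T -> #|val T :\ a| = n.
  by move=> aT; have := cardsD1 a (val T); rewrite aT card_brick => -[].
apply: eq_card => F; apply/imsetP/imsetP => [[T']|[a]].
- rewrite inE => /andP[sf PF] ->.
  have : #|val T :\: val T'| = 1.
    by have := cardsID (val T') (val T); rewrite card_brick (eqP sf); lia.
  move/eqP/cards1P => [a Ta]; have aT : a \in val T.
    by have := set11 a; rewrite -Ta inE => /andP[].
  have eqF : val T :&: val T' = val T :\ a.
    by rewrite -Ta setDDr setDv set0U.
  by exists a; rewrite ?inE ?aT -?eqF.
- rewrite inE => /andP[aT PF] ->.
  have [T' ne sub] := facet_brick_other (cD a aT) (subD1set _ _).
  have capF : val T :&: val T' = val T :\ a.
    by apply: facet_brick_capE; rewrite ?cD ?subD1set // eq_sym.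
  by exists T'; rewrite ?inE ?capF // /shares_facet capF cD ?eqxx.
Qed.

Lemma sum_nat_card (W : finType) (A : {set W}) (P : pred W) :
  \sum_(x in A) (P x : nat) = #|[set x in A | P x]|.
Proof.
rewrite -sum1_card [RHS](eq_bigl (fun x => (x \in A) && P x)).
  by rewrite big_mkcondr.
by move=> x; rewrite inE.
Qed.

Lemma shares_facet_reg T : edges shares_facet [set T] setT = n.+1.
Proof.
rewrite edges1l sum_nat_card -(card_brick T).
transitivity #|[set a in val T | predT (val T :\ a)]|.
  by rewrite -(card_cofaces predT); apply: eq_card => T'; rewrite !inE andbT.
by apply: eq_card => a; rewrite inE andbT.
Qed.

Lemma shares_facet_connected (S : {set brick n K}) :
  cut shares_facet S = 0 -> S = set0 \/ S = setT.
Proof.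
move=> cut0; have [->|[T TS]] := set_0Vmem S; first by left.
right; apply/setP => T'; rewrite inE.
have closedS T1 T2 : shares_facet T1 T2 -> T1 \in S -> T2 \in S.
  move=> sf T1S; apply: contra_eqT cut0 => T2S; rewrite -lt0n /cut /edges.
  by rewrite (bigD1 T1) //= (bigD1 T2) ?inE //= sf.
case: K_pm => _ _ _ _ /(_ _ _ (valP T) (valP T')) /connectP[p].
elim: p T TS => [|B p IHp] T TS /=; first by move=> _ /val_inj ->.
move=> /andP[/and4P[_ BK ne /existsP[F /and3P[]]]].
rewrite inE => /andP[_ /eqP cF] FT FB pth lst.
apply: (IHp (Sub B BK)) => //; apply: closedS TS.
by rewrite /shares_facet (@facet_brick_capE F) ?cF.
Qed.

Variable C : brick n K.

(** Let E be the ridge common to the facets of [C] towards [u] and [v].  The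
    neighbour relation around E is 2-regular on the bricks that contain E, so an
    even number of its edges leave [A].  The edge from [u] to [C] is one of them,
    and the only one that ends in [C]; hence there is another one. *)
Lemma ridge_crossing (A : {set brick n K}) u v : C \notin A ->
  u \in A -> shares_facet C u -> shares_facet C v -> v \notin A ->
  exists x y, [/\ x \in A, y \notin A, y != C, shares_facet x y &
    val C :&: val u :&: val v \subset val x :&: val y].
Proof.
move=> CA uA uN vN vA.
set E := val C :&: val u :&: val v.
have uv : u != v by apply: contraNneq vA => <-.
pose h x y := shares_facet x y && (E \subset val x :&: val y).
have h_sym : symmetric h by move=> x y; rewrite /h shares_facet_sym setIC.
have h_irr : irreflexive h by move=> x; rewrite /h shares_facet_irr.
(* Two different facets of C meet in n - 1 vertices; the facets towards u and
   v are different, as a facet lies in only two bricks. *)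
have cE : #|E| = n.-1.
  have D1 : #|val C :\: val u| = 1.
    by have := cardsID (val u) (val C); rewrite card_brick (eqP uN); lia.
  have D2 : #|val C :\: val v| = 1.
    by have := cardsID (val v) (val C); rewrite card_brick (eqP vN); lia.
  have cle : #|val C :\: (val u :&: val v)| <= 2.
    by rewrite setDIr (leq_trans (leq_card_setU _ _)) // D1 D2.
  have ge : n.-1 <= #|E|.
    by have := cardsID (val u :&: val v) (val C); rewrite card_brick setIA -/E; lia.
  suff : #|E| < n by lia.
  rewrite ltnNge; apply/negP => nE.
  move/eqP: uv; apply; apply: (@facet_brick_uniq (val C :&: val u) C).
  - exact/eqP.
  - exact: subsetIl.
  - exact: subsetIr.
  - have -> : val C :&: val u = E.
      by apply/esym/eqP; rewrite eqEcard subsetIl (eqP uN).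
    exact: subsetIr.
  - exact: shares_facet_neq.
  - exact: shares_facet_neq.
(* The facets of x that contain E omit one of the two vertices outside E. *)
have h_reg x : edges h [set x] setT = if E \subset val x then 2 else 0.
  rewrite edges1l sum_nat_card; case: ifP => Ex.
    transitivity #|val x :\: E|; last first.
      have := cardsID E (val x); rewrite (setIidPr Ex) cE card_brick; lia.
    transitivity #|[set a in val x | E \subset val x :\ a]|.
      rewrite -(card_cofaces (fun F => E \subset F)); apply: eq_card => y.
      by rewrite !inE.
    by apply: eq_card => a; rewrite [LHS]inE [RHS]in_setD subsetD1 Ex andbC.
  apply/eqP; rewrite cards_eq0; apply/eqP/setP => y.
  by rewrite !inE /h subsetI Ex andbF.
have evenAT : ~~ odd (edges h A setT).
  rewrite /edges; apply: (big_ind (fun k => ~~ odd k)) => // [a b|x _].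
    by rewrite oddD => /negbTE -> /negbTE ->.
  by rewrite -edges1l h_reg; case: ifP.
have hC : [set y | h C y] = [set u; v].
  apply/esym/eqP; rewrite eqEcard; apply/andP; split.
    apply/subsetP => y; rewrite !inE => /orP[]/eqP->; rewrite /h ?uN ?vN subsetI.
      by rewrite /E -setIA subsetIl setIC -setIA subsetIl.
    by rewrite subsetIr /E -setIA subsetIl.
  have := h_reg C; rewrite edges1l sum_nat_card {1}/E -setIA subsetIl cards2 uv.
  by move=> <-; apply/eq_leq/eq_card => y; rewrite !inE.
have AC : edges h A [set C] = 1.
  rewrite edgesC // edges1l sum_nat_card (_ : [set x in A | h C x] = [set u]) ?cards1 //.
  apply/setP => y; have : (y \in [set y | h C y]) = (y \in [set u; v]) by rewrite hC.
  rewrite !inE => ->.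
  case: eqP => [->|_] /=; first by rewrite uA.
  by case: eqP => [->|_]; rewrite ?andbF // (negbTE vA).
have : 0 < edges h A (~: A :\ C).
  have := edges_even A h_sym h_irr.
  move: evenAT; rewrite (edges_splitr h A) setTI setTD.
  rewrite (edges_splitr h [set C] _ (~: A)).
  have -> : ~: A :&: [set C] = [set C] by apply/setIidPr; rewrite sub1set inE.
  by rewrite AC addnCA oddD; case: (edges h A (_ :\ _)); rewrite ?addn0 //=; case: odd.
move/edges_gt0 => [x [y [xA]]]; rewrite !inE => /andP[yC yA] /andP[sf sub].
by exists x, y.
Qed.

(** Double counting of the incidences between pairs (u, v) of neighbours of [C],
    with u in [A] and v outside, and edges (x, y) that leave [A] avoiding [C].
    Each pair has an edge around its ridge, and each edge serves one pair only:
    two different ridges of [C] in the facet of x and y would span it, which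
    would make it a facet of the three bricks x, y and [C]. *)
Lemma link_well_connected (A : {set brick n K}) : C \notin A ->
  edges shares_facet A [set C] * edges shares_facet (~: A :\ C) [set C]
    <= edges shares_facet A (~: A :\ C).
Proof.
move=> CA; set A' := ~: A :\ C.
have eC B : edges shares_facet B [set C] = #|[set u in B | shares_facet C u]|.
  by rewrite (edgesC shares_facet_sym) edges1l sum_nat_card.
pose I := setX [set u in A | shares_facet C u] [set v in A' | shares_facet C v].
pose r (p p' : brick n K * brick n K) :=
  val C :&: val p.1 :&: val p.2 \subset val p'.1 :&: val p'.2.
pose J := [set p in setX A A' | shares_facet p.1 p.2].
have -> : edges shares_facet A A' = #|J|.
  rewrite /edges pair_big /= -sum_nat_card.
  by apply: eq_bigl => -[u v]; rewrite in_setX.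
rewrite !eC -cardsX -/I -sum1_card -[#|J|]sum1_card.
apply: (@leq_trans (\sum_(p in I) \sum_(p' in J) r p p')).
  apply: leq_sum => -[u v]; rewrite !inE /= => /andP[/andP[uA uN] /andP[/andP[vC vA] vN]].
  have [|||||x [y [xA yA yC sf sub]]] := @ridge_crossing A u v; rewrite ?inE //.
  rewrite (bigD1 (x, y)) /=; first by rewrite /r /= sub leq_addr.
  by rewrite !inE /= xA yC yA.
rewrite exchange_big; apply: leq_sum => -[x y]; rewrite !inE /=.
move=> /andP[/andP[xA /andP[yC yA]] sf].
rewrite sum_nat_card; apply/card_le1_eqP => -[u v] [u' v']; rewrite !inE /r /=.
move=> /andP[/andP[/andP[uA uN] /andP[/andP[vC vA] vN]] sub].
move=> /andP[/andP[/andP[u'A u'N] /andP[/andP[v'C v'A] v'N]] sub'].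
set D := val C :\: (val x :&: val y).
(* The facet shared by x and y is not a face of C. *)
have cD : 1 < #|D|.
  rewrite /D cardsD card_brick ltn_subRL addn1 ltnS ltnNge; apply/negP => nC.
  have eqF : val x :&: val y = val C :&: (val x :&: val y).
    by apply/esym/eqP; rewrite eqEcard subsetIr (eqP sf).
  have FC : val x :&: val y \subset val C by rewrite eqF subsetIl.
  have xC : x != C by apply: contraNneq CA => <-.
  move: yA; rewrite (_ : y = x) ?xA //.
  apply: (facet_brick_uniq (eqP sf) FC) => //; [exact: subsetIr | exact: subsetIl].
have miss w : shares_facet C w -> exists a, val C :\: val w = [set a].
  move=> wN; apply/cards1P; rewrite cardsD card_brick (eqP wN) subSnn //.
have DE w z : shares_facet C w -> shares_facet C z ->
    val C :&: val w :&: val z \subset val x :&: val y ->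
    D = (val C :\: val w) :|: (val C :\: val z).
  move=> /miss[a Ca] /miss[b Cb] sub1.
  apply/eqP; rewrite eqEcard -setDIr; apply/andP; split.
    apply/subsetP => c; rewrite !inE => /andP[nxy cC]; rewrite cC andbT.
    apply: contra nxy => cwz; have := subsetP sub1 c.
    by rewrite !inE cC -andbA cwz => /(_ isT).
  apply: leq_trans cD; rewrite setDIr Ca Cb.
  by apply: leq_trans (leq_card_setU _ _) _; rewrite !cards1.
have nbr w z a : shares_facet C w -> shares_facet C z ->
    a \in val C :\: val w -> a \in val C :\: val z -> w = z.
  move=> wN zN aw az.
  have eqD : val C :\: val w = val C :\: val z.
    have [b Cb] := miss _ wN; have [c Cc] := miss _ zN.
    by move: aw az; rewrite Cb Cc !inE => /eqP-> /eqP->.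
  have eqF : val C :&: val w = val C :&: val z.
    by rewrite -[LHS]set0U -[RHS]set0U -(setDv (val C)) -!setDDr eqD.
  apply: (@facet_brick_uniq (val C :&: val w) C); rewrite ?subsetIl ?subsetIr //.
  - exact/eqP.
  - by rewrite eqF subsetIr.
  - exact: shares_facet_neq.
  - exact: shares_facet_neq.
have D1 := DE u v uN vN sub; have D2 := DE u' v' u'N v'N sub'.
have [a Ca] := miss _ uN; have [b Cb] := miss _ vN.
have au : a \in val C :\: val u by rewrite Ca set11.
have bv : b \in val C :\: val v by rewrite Cb set11.
have : a \in D by rewrite D1 in_setU au.
rewrite D2 in_setU => /orP[au'|av']; last first.
  by move: v'A; rewrite -(nbr u v' a) // uA.
have : b \in D by rewrite D1 in_setU bv orbT.
rewrite D2 in_setU => /orP[bu'|bv'].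
  by move: vA; rewrite (nbr v u' b) // u'A.
by rewrite (nbr u u' a) // (nbr v v' b).
Qed.

End DualGraph.

(** * The width as a minimum over cut profiles *)

Section WidthOfCuts.

Variables (V : finType) (n : nat) (K : {set {set V}}).
Hypothesis n_gt0 : 0 < n.
Hypothesis n_even : ~~ odd n.
Hypothesis K_pm : pseudomanifold n K.

Notation dual := (@shares_facet V n K).
Notation N := (nb_bricks n K).

(** A facet determines the two bricks that it separates. *)
Lemma Lambda_cut (O : {ffun brick n K -> 'I_N}) j :
  Lambda O j = cut dual [set T | label O T <= j].
Proof.
set S := [set T | _].
pose J := [set p in setX S (~: S) | dual p.1 p.2].
have -> : cut dual S = #|J|.
  rewrite /cut /edges pair_big /= -sum_nat_card.
  by apply: eq_bigl => -[u v]; rewrite in_setX.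
rewrite -(@card_in_imset _ _ (fun p => val p.1 :&: val p.2)).
  apply: eq_card => F; apply/idP/imsetP.
    rewrite !inE => /andP[/andP[_ /eqP cF] /existsP[T /existsP[T']]].
    move=> /and4P[Tj jT' FT FT'].
    have ne : T != T' by apply: contraTneq Tj => ->; rewrite -ltnNge.
    have capE : val T :&: val T' = F by apply: facet_brick_capE.
    exists (T, T') => //=.
    by rewrite !inE /= Tj -ltnNge jT' /shares_facet capE cF eqxx.
  move=> [[T T']]; rewrite !inE /= -ltnNge => /andP[/andP[Tj jT'] /eqP cF] ->.
  have := sub_brick_facet n_gt0 K_pm (subsetIl (val T) (val T')) cF.
  rewrite inE => -> /=; apply/existsP; exists T; apply/existsP; exists T'.
  by rewrite Tj jT' subsetIl subsetIr.
move=> [u v] [u' v']; rewrite inE in_setX in_setC /= => /andP[/andP[uS vS] /eqP cF].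
rewrite inE in_setX in_setC /= => /andP[/andP[u'S v'S] /eqP cF'] eqF.
have uniqF := facet_brick_uniq n_gt0 K_pm cF.
have subs : [/\ val u :&: val v \subset val u, val u :&: val v \subset val v,
    val u :&: val v \subset val u' & val u :&: val v \subset val v'].
  by rewrite subsetIl subsetIr eqF subsetIl subsetIr.
case: subs => s1 s2 s3 s4.
have neS x y : x \in S -> y \notin S -> y != x.
  by move=> xS; apply: contraNneq => ->.
congr (_, _).
- by apply: (uniqF v) => //; rewrite eq_sym neS.
- by apply: (uniqF u) => //; rewrite neS.
Qed.

Lemma seq_of_ordering (O : {ffun brick n K -> 'I_N}) : is_ordering O ->
  exists s : seq (brick n K),
    [/\ uniq s, forall T, T \in s & forall T, index T s = O T].
Proof.
move=> /andP[/injectiveP O_inj _].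
have [h hK Kh] : bijective O by apply: inj_card_bij => //; rewrite card_ord.
exists [seq h i | i <- enum 'I_N]; split.
- by rewrite map_inj_uniq ?enum_uniq //; apply: can_inj Kh.
- by move=> T; rewrite -(hK T) map_f // mem_enum.
- move=> T; rewrite -{1}(hK T) index_map; last exact: can_inj Kh.
  by rewrite index_enum_ord.
Qed.

Lemma ordering_of_seq (s : seq (brick n K)) : uniq s -> (forall T, T \in s) ->
  exists2 O : {ffun brick n K -> 'I_N}, is_ordering O &
    forall T, index T s = O T.
Proof.
move=> us fs; have szs : size s = N.
  by rewrite -(card_uniqP us); apply: eq_card => T; rewrite fs.
have lt T : index T s < N by rewrite -szs index_mem.
exists [ffun T => Ordinal (lt T)]; last by move=> T; rewrite ffunE.
apply/andP; split.
  apply/injectiveP => T T'; rewrite !ffunE => -[].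
  by apply: index_inj; rewrite ?fs.
apply/forallP => j; apply/existsP.
have x0 : brick n K.
  by case: (s) szs => [|x _ _] //; case: j => j /=; case: N.
exists (nth x0 s j); rewrite ffunE -val_eqE /= index_uniq // szs //.
Qed.

(** Without plateaus, the constant stretch around a local maximum has length
    one. *)
Lemma ordering_width_profile (O : {ffun brick n K -> 'I_N}) (s : seq (brick n K)) :
  uniq s -> (forall T, T \in s) -> (forall T, index T s = O T) ->
  ordering_width O = peak_width (cut_profile dual s) (size s).
Proof.
move=> us fs iO; have szs : size s = N.
  by rewrite -(card_uniqP us); apply: eq_card => T; rewrite fs.
have LE j : Lambda O j = cut_profile dual s j.
  rewrite Lambda_cut /cut_profile; congr cut; apply/setP => T.
  by rewrite in_prefix_set // inE iO.
have noplateau j : j < N -> Lambda O j <> Lambda O j.+1.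
  move=> jN; rewrite !LE; apply: cut_profile_noplateau => //.
  - exact: shares_facet_sym.
  - exact: shares_facet_irr.
  - exact: (shares_facet_reg n_gt0 K_pm).
  - exact: n_even.
  - by rewrite szs.
rewrite /ordering_width /peak_width /peaks szs; congr sort.
rewrite (eq_map LE); congr map; apply: eq_in_filter => t.
rewrite mem_iota => tN; rewrite /peak -!LE.
apply/existsP/andP => [[tm /existsP[tp /and5P[tmt ttp up dn /forallP flat]]]|[up dn]].
- have flatP k : tm < k < tp -> Lambda O t = Lambda O k.
    move=> /andP[h1 h2]; have kN : k < N.+1 by have := ltn_ord tp; lia.
    by apply/eqP; have := flat (Ordinal kN); rewrite /= h1 h2.
  have tN1 : t.-1.+1 = t by lia.
  have tmE : tm.+1 = t.
    apply/eqP; rewrite eqn_leq tmt leqNgt; apply/negP => lt.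
    by apply: (@noplateau t.-1); [lia | rewrite tN1 -(flatP t.-1) //; lia].
  have tpE : tp.-1 = t.
    apply/eqP; rewrite eqn_leq -ltnS; apply/andP; split; last by lia.
    rewrite leqNgt; apply/negP => lt.
    by apply: (@noplateau t); [lia | apply: flatP; lia].
  rewrite tmE in up; rewrite tpE in dn.
  by have -> : t.-1 = tm by [lia]; have -> : t.+1 = tp by lia.
- have h1 : t.-1 < N.+1 by lia.
  have h2 : t.+1 < N.+1 by lia.
  exists (Ordinal h1); apply/existsP; exists (Ordinal h2) => /=.
  have -> : t.-1.+1 = t by lia.
  rewrite up dn; apply/and5P; split => //.
  apply/forallP => k; apply/implyP => kt.
  by have -> : k = t :> nat by lia.
Qed.

Lemma width_profile : exists s : seq (brick n K),
  [/\ uniq s, forall T, T \in s &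
      width n K = peak_width (cut_profile dual s) (size s)].
Proof.
have [O ordO ->] := width_attained n K.
have [s [us fs sO]] := seq_of_ordering ordO.
by exists s; split=> //; apply: ordering_width_profile.
Qed.

Lemma width_le_profile (s : seq (brick n K)) :
  uniq s -> (forall T, T \in s) ->
  (width n K <= peak_width (cut_profile dual s) (size s))%O.
Proof.
move=> us fs; have [O ordO sO] := ordering_of_seq us fs.
by rewrite -(ordering_width_profile us fs sO); apply: width_min.
Qed.

End WidthOfCuts.

(** * Collapsing one summand of a connected sum *)

(** The two summands are given by embeddings into one vertex set.  Unlike the
    concrete connected sum, this presentation is symmetric ([glued_sym]). *)
Definition glued (V1 V2 V : finType) (i1 : V1 -> V) (i2 : V2 -> V)
    (M1 : {set {set V1}}) (M2 : {set {set V2}})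
    (C1 : {set V1}) (C2 : {set V2}) (K : {set {set V}}) : Prop :=
  [/\ injective i1, injective i2, i1 @: C1 = i2 @: C2,
      forall x y, i1 x = i2 y -> x \in C1 &
      K = [set i1 @: F | F : {set V1} in M1 :\ C1] :|:
          [set i2 @: F | F : {set V2} in M2 :\ C2]].

Lemma glued_sym (V1 V2 V : finType) (i1 : V1 -> V) (i2 : V2 -> V) M1 M2 C1 C2 K :
  glued i1 i2 M1 M2 C1 C2 K -> glued i2 i1 M2 M1 C2 C1 K.
Proof.
move=> [inj1 inj2 eqC overlap ->]; split=> //; last by rewrite setUC.
move=> y x /esym eqxy; have xC := overlap _ _ eqxy.
by rewrite -(mem_imset _ _ inj2) -eqC -eqxy imset_f.
Qed.

Section Contract.

Variables (n : nat) (V1 V2 V : finType).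
Variables (M1 : {set {set V1}}) (M2 : {set {set V2}}) (K : {set {set V}}).
Variables (i1 : V1 -> V) (i2 : V2 -> V).
Variables (c1 : brick n M1) (c2 : brick n M2).
Hypothesis n_gt0 : 0 < n.
Hypothesis M2_pm : pseudomanifold n M2.
Hypothesis K_glued : glued i1 i2 M1 M2 (val c1) (val c2) K.

Implicit Types (u v : brick n M1) (w : brick n M2) (T : brick n K).

(** Bricks of the second summand meet the first one inside [c1], so their
    preimages are not bricks other than [c1], and the default value applies. *)
Definition contract (T : brick n K) : brick n M1 := insubd c1 (i1 @^-1: val T).

Let inj1 : injective i1. Proof. by case: K_glued. Qed.
Let inj2 : injective i2. Proof. by case: K_glued. Qed.

Lemma left_brick u : u != c1 -> exists T : brick n K, val T = i1 @: val u.
Proof.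
move=> uc; case: K_glued => _ _ _ _ Keq.
have uK : i1 @: val u \in bricks n K.
  rewrite inE card_imset // card_brick eqxx andbT Keq; apply/setUP; left.
  apply: imset_f; rewrite !inE val_eqE uc.
  by have := valP u; rewrite inE => /andP[].
by exists (Sub (i1 @: val u) uK).
Qed.

Lemma contract_left u (T : brick n K) : val T = i1 @: val u -> contract T = u.
Proof.
move=> Tu; apply: val_inj; rewrite /contract val_insubd.
have -> : i1 @^-1: val T = val u.
  by apply/setP => x; rewrite inE Tu mem_imset.
by rewrite (valP u).
Qed.

Lemma contract_right w (T : brick n K) : val T = i2 @: val w -> contract T = c1.
Proof.
case: K_glued => _ _ _ overlap _ Tw; rewrite /contract /insubd.
case: insubP => [u _ valu|] //=; apply: (@brick_sub _ n) => //.
rewrite valu Tw; apply/subsetP => x; rewrite inE => /imsetP[y _].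
exact: overlap.
Qed.

Lemma brick_sides (T : brick n K) :
  (exists2 u : brick n M1, u != c1 & val T = i1 @: val u) \/
  (exists2 w : brick n M2, w != c2 & val T = i2 @: val w).
Proof.
have := valP T; move: (val T) => B; rewrite inE => /andP[].
case: K_glued => _ _ _ _ ->; case/setUP=> /imsetP[F];
  rewrite !inE => /andP[ne FM] -> cF; [left|right].
- have Fb : F \in bricks n M1 by rewrite inE FM -(card_imset _ inj1).
  by exists (Sub F Fb) => //; rewrite -val_eqE.
- have Fb : F \in bricks n M2 by rewrite inE FM -(card_imset _ inj2).
  by exists (Sub F Fb) => //; rewrite -val_eqE.
Qed.

Lemma contract_val T : contract T != c1 -> val T = i1 @: val (contract T).
Proof.
case: (brick_sides T) => [[u _ Tu]|[w _ /contract_right ->]]; last by rewrite eqxx.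
by rewrite (contract_left Tu).
Qed.

Lemma contract_base T : contract T = c1 -> exists2 w, w != c2 & val T = i2 @: val w.
Proof.
by case: (brick_sides T) => // -[u uc /contract_left ->] uc1; rewrite uc1 eqxx in uc.
Qed.

Lemma contract_inj T T' : contract T != c1 -> contract T = contract T' -> T = T'.
Proof.
move=> ne eqc; apply: val_inj; rewrite (contract_val ne) eqc -contract_val //.
by rewrite -eqc.
Qed.

(** If [u] meets [c1] in a facet, then that facet is also one of [c2], and the
    brick of the second summand on its other side is the only neighbour of [x]
    outside the first summand: the facet that [x] shares with such a neighbour
    lies in the common boundary, hence is this one. *)
Lemma contract_shares_facet u (x : brick n K) : u != c1 -> val x = i1 @: val u ->
  \sum_(y | contract y == c1) shares_facet x y = shares_facet u c1.
Proof.
move=> uc xu; case: (K_glued) => _ _ eqC overlap _.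
set F := i1 @: (val u :&: val c1).
have cF : #|F| = #|val u :&: val c1| by rewrite card_imset.
have FC : F \subset i2 @: val c2 by rewrite -eqC imsetS // subsetIr.
have Fx : F \subset val x by rewrite xu imsetS // subsetIl.
set F2 := i2 @^-1: F.
have F2E : i2 @: F2 = F.
  apply/setP => z; apply/imsetP/idP => [[y]|zF]; first by rewrite inE => ? ->.
  by have /imsetP[y _ zy] := subsetP FC z zF; exists y; rewrite // inE -zy.
have F2sub w (y : brick n K) : F \subset val y -> val y = i2 @: val w -> F2 \subset val w.
  move=> + yw; rewrite yw -F2E => /subsetP sub; apply/subsetP => z zF.
  by rewrite -(mem_imset _ _ inj2) sub // imset_f.
have F2c : F2 \subset val c2.
  apply/subsetP => z zF; rewrite -(mem_imset _ _ inj2) (subsetP FC) //.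
  by rewrite -F2E imset_f.
have capF (y : brick n K) w : val y = i2 @: val w -> val x :&: val y \subset F.
  move=> yw; apply/subsetP => z; rewrite xu yw inE => /andP[/imsetP[a au ->]].
  move=> /imsetP[b bw ab]; apply: imset_f; rewrite inE au /=.
  exact: overlap ab.
have sfF y : contract y = c1 -> shares_facet x y ->
    shares_facet u c1 /\ F \subset val y.
  move=> /contract_base[w _ /capF cap] /eqP sf.
  have cle := card_cap_bricks uc; have := subset_leq_card cap.
  rewrite sf cF => nle.
  have eqn : #|val u :&: val c1| = n by apply/eqP; rewrite eqn_leq cle.
  split; first by apply/eqP.
  have /eqP <- : val x :&: val y == F by rewrite eqEcard cap cF eqn sf leqnn.
  exact: subsetIr.
have [sfu|nsfu] := boolP (shares_facet u c1); last first.
  rewrite big1 // => y /eqP yc; apply/eqP; rewrite eqb0.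
  by apply: contra nsfu => /(sfF _ yc)[].
have cF2 : #|F2| = n by rewrite -(card_imset _ inj2) F2E cF; apply/eqP.
have [w wc F2w] := facet_brick_other n_gt0 M2_pm cF2 F2c.
have [y yw] : exists y : brick n K, val y = i2 @: val w.
  case: (K_glued) => _ _ _ _ Keq.
  have wK : i2 @: val w \in bricks n K.
    rewrite inE card_imset // card_brick eqxx andbT Keq; apply/setUP; right.
    apply: imset_f; rewrite !inE val_eqE wc.
    by have := valP w; rewrite inE => /andP[].
  by exists (Sub (i2 @: val w) wK).
have yc := contract_right yw.
have Fy : F \subset val y by rewrite yw -F2E imsetS.
have xy : x != y by apply: contraNneq uc => xy; rewrite -(contract_left xu) xy yc.
have cFn : #|F| = n by rewrite cF; apply/eqP.
have sfxy : shares_facet x y.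
  by rewrite /shares_facet (facet_brick_capE cFn xy Fx Fy) cFn.
rewrite (bigD1 y) /= ?yc // sfxy big1 // => y' /andP[/eqP y'c ne].
apply/eqP; rewrite eqb0; apply: contra_neqN ne => sf'.
have [w' w'c y'w'] := contract_base y'c.
have [_ Fy'] := sfF _ y'c sf'.
have ww : w' = w.
  exact: (facet_brick_uniq n_gt0 M2_pm cF2 F2c (F2sub _ _ Fy' y'w') F2w).
by apply: val_inj; rewrite y'w' yw ww.
Qed.

Notation sfK := (@shares_facet V n K).
Notation sf1 := (@shares_facet V1 n M1).

Lemma contract_fibre u : u != c1 -> exists2 x, val x = i1 @: val u &
  forall y, (contract y == u) = (y == x).
Proof.
move=> uc; have [x xu] := left_brick uc; exists x => // y.
apply/eqP/eqP => [yu|->]; last exact: contract_left.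
by apply: contract_inj; rewrite yu // (contract_left xu).
Qed.

Lemma contract_pair u v : u != v ->
  \sum_(x | contract x == u) \sum_(y | contract y == v) sfK x y = sf1 u v.
Proof.
have base u' : u' != c1 ->
    \sum_(x | contract x == u') \sum_(y | contract y == c1) sfK x y = sf1 u' c1.
  move=> uc; have [x xu fib] := contract_fibre uc.
  by rewrite (eq_bigl _ _ fib) big_pred1_eq; apply: contract_shares_facet.
move=> uv; case: (eqVneq v c1) uv => [->|vc uv]; first exact: base.
case: (eqVneq u c1) uv => [-> cv|uc uv].
  rewrite exchange_big /= shares_facet_sym -base //.
  apply: eq_bigr => x _; apply: eq_bigr => y _; by rewrite shares_facet_sym.
have [x xu fibx] := contract_fibre uc; have [y yv fiby] := contract_fibre vc.
rewrite (eq_bigl _ _ fibx) big_pred1_eq (eq_bigl _ _ fiby) big_pred1_eq.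
by rewrite /shares_facet xu yv -imsetI ?card_imset // => a b _ _; apply: inj1.
Qed.

Lemma edges_contract (A A' : {set brick n M1}) : [disjoint A & A'] ->
  edges sfK (contract @^-1: A) (contract @^-1: A') = edges sf1 A A'.
Proof.
move=> dis; rewrite /edges (partition_big contract (mem A)) /=; last first.
  by move=> x; rewrite inE.
apply: eq_bigr => u uA.
rewrite (eq_bigl (fun x => contract x == u)); last first.
  by move=> x; rewrite inE; case: eqP => [->|_]; rewrite ?uA ?andbF.
transitivity (\sum_(x | contract x == u) \sum_(v in A')
    \sum_(y | contract y == v) sfK x y).
  apply: eq_bigr => x _; rewrite (partition_big contract (mem A')) /=; last first.
    by move=> y; rewrite inE.
  apply: eq_bigr => v vA; apply: eq_bigl => y.
  by rewrite inE; case: eqP => [->|_]; rewrite ?vA ?andbF.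
rewrite exchange_big; apply: eq_bigr => v vA; apply: contract_pair.
by apply: contraTneq vA => <-; rewrite (disjointFr dis).
Qed.

Lemma cut_contract (A : {set brick n M1}) :
  cut sf1 A = cut sfK (contract @^-1: A).
Proof.
rewrite /cut -edges_contract; last by rewrite -setI_eq0 setICr.
by congr edges; apply/setP => x; rewrite !inE.
Qed.

End Contract.

(** * The width of a connected sum *)

Section GluedWidth.

Variables (n : nat) (V1 V2 V : finType).
Variables (M1 : {set {set V1}}) (M2 : {set {set V2}}) (K : {set {set V}}).
Variables (i1 : V1 -> V) (i2 : V2 -> V).
Variables (c1 : brick n M1) (c2 : brick n M2).
Hypothesis n_gt1 : 1 < n.
Hypothesis n_even : ~~ odd n.
Hypothesis M1_pm : pseudomanifold n M1.
Hypothesis M2_pm : pseudomanifold n M2.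
Hypothesis K_pm : pseudomanifold n K.
Hypothesis K_glued : glued i1 i2 M1 M2 (val c1) (val c2) K.

Let n_gt0 : 0 < n. Proof. exact: ltnW. Qed.
Let glued21 := glued_sym K_glued.

Notation sfK := (@shares_facet V n K).
Notation sf2 := (@shares_facet V2 n M2).
Notation ctr1 := (@contract n V1 V M1 K i1 c1).
Notation ctr2 := (@contract n V2 V M2 K i2 c2).

Let Q : {set brick n K} := [set T | ctr1 T != c1].

Lemma left_sideE T : (T \in Q) = (ctr2 T == c2).
Proof.
rewrite inE; case: (brick_sides K_glued T) => [[u uc Tu]|[w wc Tw]].
- rewrite (contract_left K_glued Tu) uc; apply/esym/eqP.
  exact: (contract_right glued21 Tu).
- rewrite (contract_right K_glued Tw) eqxx (contract_left glued21 Tw).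
  by rewrite (negbTE wc).
Qed.

Lemma preim_c2 : ctr2 @^-1: [set c2] = Q.
Proof. by apply/setP => T; rewrite left_sideE !inE. Qed.

Lemma edges_Q (A : {set brick n M2}) : c2 \notin A ->
  edges sfK (ctr2 @^-1: A) Q = edges sf2 A [set c2].
Proof.
move=> cA; rewrite -preim_c2 (edges_contract n_gt0 M1_pm glued21) //.
by rewrite disjoint_sym disjoints1.
Qed.

Lemma right_preim (B : {set brick n K}) : B \subset ~: Q ->
  c2 \notin ctr2 @: B /\ ctr2 @^-1: (ctr2 @: B) = B.
Proof.
move=> /subsetP BQ; split.
  by apply/imsetP => -[T /BQ]; rewrite inE left_sideE => /eqP ne /esym.
apply/setP => T; rewrite inE; apply/imsetP/idP => [[T' T'B eqT]|]; last by exists T.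
rewrite (contract_inj glued21 _ eqT) //; rewrite -?eqT.
by have := BQ _ T'B; rewrite inE left_sideE eqT.
Qed.

(** The connectivity facts about the bricks outside [Q] are read off in the
    second summand, by collapsing [Q] to [c2]; the ordering of the first one is
    the image of the bricks in [Q] and of [b], which maps to [c1]. *)
Lemma width_glued_le : (width n M1 <= width n K)%O.
Proof.
have sfK_sym := @shares_facet_sym V n K.
have sf2_sym := @shares_facet_sym V2 n M2.
have regK : forall T, edges sfK [set T] setT = n.+1.
  exact: (shares_facet_reg n_gt0 K_pm).
have [s [us fs ->]] := width_profile n_gt0 n_even K_pm.
have [||x xQ||B BQ|b bQ wle] :=
  @contracted_width _ sfK n.+1 Q sfK_sym (@shares_facet_irr V n K) regK
    _ _ (shares_facet_connected K_pm) _ _ _ s us fs.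
- exact: n_even.
- by rewrite ltnS.
- have [] : c2 \notin [set ctr2 x] /\ ctr2 @^-1: [set ctr2 x] = [set x].
    by have := @right_preim [set x]; rewrite imset_set1 sub1set inE; apply.
  move=> cx {1}<-; rewrite edges_Q // edges1l big_set1; by case: (sf2 _ _).
- have -> : ~: Q = ctr2 @^-1: (~: [set c2]).
    by rewrite preimsetC preim_c2.
  rewrite edges_Q ?inE ?negbK ?eqxx // (edgesC sf2_sym).
  have := shares_facet_reg n_gt0 M2_pm c2.
  rewrite (edges_splitr sf2 [set c2]) setTI setTD.
  by rewrite {1}edges1l big_set1 shares_facet_irr.
- have [cB BE] := right_preim BQ.
  have C'E : ctr2 @^-1: (~: (ctr2 @: B) :\ c2) = ~: Q :\: B.
    apply/setP => T; rewrite -[in RHS]BE !inE -left_sideE inE.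
    by rewrite andbC negbK.
  rewrite -C'E -{1 3}BE !edges_Q //; last by rewrite !inE eqxx.
  rewrite (edges_contract n_gt0 M1_pm glued21); last first.
    by rewrite -setI_eq0 setDE setIA setICr set0I.
  exact: (link_well_connected n_gt0 M2_pm).
set a := predU1 b (mem Q).
have aE T : (T \in Q) || (T == b) = a T by rewrite orbC.
(* The induced ordering of the first summand. *)
pose s1 := [seq ctr1 T | T <- s & a T].
have ctrb : ctr1 b = c1 by move: bQ; rewrite inE negbK => /eqP.
have inj_a T T' : a T -> a T' -> ctr1 T = ctr1 T' -> T = T'.
  rewrite -!aE !inE => aT aT' eqc.
  have [Tc|/eqP Tc] := eqVneq (ctr1 T) c1; last first.
    by apply: (contract_inj K_glued) eqc; apply/eqP.
  by move: aT aT'; rewrite -eqc Tc eqxx /= => /eqP-> /eqP->.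
have us1 : uniq s1.
  rewrite map_inj_in_uniq ?filter_uniq // => T T'; rewrite !mem_filter.
  by move=> /andP[aT _] /andP[aT' _]; apply: inj_a.
have fs1 u : u \in s1.
  have [->|uc] := eqVneq u c1.
    by rewrite -ctrb map_f // mem_filter fs andbT -aE eqxx orbT.
  have [T Tu] := left_brick K_glued uc.
  rewrite -(contract_left K_glued Tu) map_f // mem_filter fs andbT -aE inE.
  by rewrite (contract_left K_glued Tu) uc.
have sz1 : size s1 = count a s by rewrite size_map size_filter.
apply: le_trans (width_le_profile n_gt0 n_even M1_pm us1 fs1) _.
rewrite sz1; apply: wle => j js; rewrite /cut_profile.
rewrite (cut_contract n_gt0 M2_pm K_glued); congr cut.
have takeE : take (count a (take j s)) s1 = [seq ctr1 T | T <- take j s & a T].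
  by rewrite -map_take -{2}(cat_take_drop j s) filter_cat -size_filter take_size_cat.
apply/setP => T; rewrite in_set in_set takeE.
(* Outside Q, the collapsed vertex precedes exactly when b does. *)
have mem_ctr : (ctr1 T \in [seq ctr1 T' | T' <- take j s & a T']) =
    if T \in Q then T \in take j s else b \in take j s.
  have [TQ|TQ] := boolP (T \in Q).
    apply/mapP/idP => [[T' + eqT]|Tj].
      rewrite mem_filter => /andP[aT' T'j].
      by rewrite (inj_a T T') // -aE TQ.
    by exists T; rewrite // mem_filter -aE TQ.
  have Tc : ctr1 T = ctr1 b by move: TQ; rewrite inE negbK ctrb => /eqP.
  apply/mapP/idP => [[T' + eqT]|bj].
    rewrite mem_filter => /andP[aT' T'j].
    by rewrite (inj_a b T') -?Tc // -aE eqxx orbT.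
  by exists b; rewrite // mem_filter -aE eqxx orbT.
have inP U : (U \in prefix_set s j) = (U \in take j s) by rewrite inE.
rewrite mem_ctr inP; case: (b \in take j s).
  by rewrite in_setU in_setC inP; case: (T \in Q); rewrite ?orbT ?orbF.
by rewrite in_setI inP; case: (T \in Q); rewrite ?andbT ?andbF.
Qed.

End GluedWidth.

(** Vertices and ends of the gluing map are recovered from singleton faces, which
    are proper because the glued simplices have at least two vertices. *)
Lemma connected_sum_glued (V1 V2 : finType) (M1 : {set {set V1}})
    (M2 : {set {set V2}}) (C1 : {set V1}) (C2 : {set V2}) (phi : V1 -> V2) :
  1 < #|C1| -> 1 < #|C2| ->
  simplicial_homeo (boundary C1) (boundary C2) phi ->
  glued (glue C1 phi) inr M1 M2 C1 C2 (connected_sum M1 M2 C1 C2 phi).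
Proof.
move=> c1 c2 [phi_inj phi_im].
have vertex (U : finType) (C : {set U}) x : 1 < #|C| -> x \in C ->
    [set x] \in boundary C.
  move=> cC xC; rewrite inE -card_gt0 cards1 andbT properEcard sub1set xC.
  by rewrite cards1.
have in_vertices x : x \in C1 -> x \in vertices (boundary C1).
  by move=> xC; apply/bigcupP; exists [set x]; rewrite ?vertex ?set11.
have phiC : phi @: C1 = C2.
  apply/setP => y; apply/imsetP/idP => [[x xC ->]|yC].
    have := imset_f (fun F : {set V1} => phi @: F) (vertex _ _ _ c1 xC).
    by rewrite phi_im imset_set1 inE => /andP[/proper_sub]; rewrite sub1set.
  have := vertex _ _ _ c2 yC; rewrite -phi_im => /imsetP[F].
  rewrite inE => /andP[/proper_sub/subsetP FC _] yF.
  have := set11 y; rewrite yF => /imsetP[x xF ->]; exists x => //.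
  exact: FC.
split=> //.
- move=> x y; rewrite /glue; case: ifP => xC; case: ifP => yC // [] //.
  by apply: phi_inj; apply: in_vertices.
- by move=> x y [].
- rewrite -phiC -imset_comp; apply: eq_in_imset => x xC.
  by rewrite /glue xC.
- by move=> x y; rewrite /glue; case: ifP.
Qed.

Theorem theorem5p1 (n : nat) (V1 V2 : finType)
    (M1 : {set {set V1}}) (M2 : {set {set V2}})
    (C1 : {set V1}) (C2 : {set V2}) (phi : V1 -> V2)
    (hn : 2 <= n) (n_even : ~~ odd n)
    (hM1 : pseudomanifold n M1) (hM2 : pseudomanifold n M2)
    (hC1 : C1 \in bricks n M1) (hC2 : C2 \in bricks n M2)
    (hphi : simplicial_homeo (boundary C1) (boundary C2) phi)
    (hM : pseudomanifold n (connected_sum M1 M2 C1 C2 phi)) :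
  (Order.max (width n M1) (width n M2)
     <= width n (connected_sum M1 M2 C1 C2 phi))%O.
Proof.
have [cC1 cC2] : 1 < #|C1| /\ 1 < #|C2|.
  by move: hC1 hC2; rewrite !inE => /andP[_ /eqP->] /andP[_ /eqP->]; lia.
have gl := connected_sum_glued M1 M2 cC1 cC2 hphi.
pose c1 : brick n M1 := Sub C1 hC1; pose c2 : brick n M2 := Sub C2 hC2.
rewrite ge_max; apply/andP; split.
- exact: (@width_glued_le n _ _ _ _ _ _ _ _ c1 c2 hn n_even hM1 hM2 hM gl).
- apply: (@width_glued_le n _ _ _ _ _ _ _ _ c2 c1 hn n_even hM2 hM1 hM).
  exact: glued_sym gl.
Qed.
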